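(* Let $B$ be a monomial ideal of $S$ and let $B_1,\dots,B_t$ be a family of monomial ideals of $S$ with $\mathbb{V}(B)=\bigcup_{i=1}^t\mathbb{V}(B_i)$. Let $M$ be a $G$-graded $S$-module and $\mathcal{C}=\{\mathbf{c}_1,\dots,\mathbf{c}_l\}\subseteq G$. Then $$\mathrm{reg}_{B_*,\mathcal{C}}(M)\subseteq\mathrm{reg}_{B,\mathcal{C}}(M).$$
   Context: $R$ is a commutative Noetherian ring, $G$ is a finitely generated abelian group, and $S=R[x_1,\dots,x_n]$ is a $G$-graded polynomial $R$-algebra (each $x_i$ homogeneous, $R$ in degree $\mathbf 0$). $\mathbb{V}(\cdot)$ denotes the closed subset of $\mathrm{Spec}(S)$ defined by an ideal. For $\emptyset\ne I\subseteq[t]=\{1,\dots,t\}$ put $B_I=\sum_{i\in I}B_i$, so $\mathbb{V}(B_I)=\bigcap_{i\in I}\mathbb{V}(B_i)$. $\mathbb{N}=\mathbb{Z}_{\ge0}$; $\mathbb{N}\mathcal{C}$ is the sub-semigroup of $G$ (containing $\mathbf{0}$) generated by $\mathcal{C}$; for $j\in\mathbb{Z}$, $\mathbb{N}\mathcal{C}[j]=\bigcup_{\mathbf{w}\in\mathbb{N}^l,\ \sum w_i=|j|}(\mathrm{sign}(j)\sum_iw_i\mathbf{c}_i+\mathbb{N}\mathcal{C})$, with $\mathbb{N}\mathcal{C}[0]=\mathbb{N}\mathcal{C}$. For a $G$-graded ideal $A\subset S$, $\mathcal{Z}^i_A(M)=\{\mathbf{p}\in G:H^i_A(M)_{\mathbf{p}}=0\}$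 where $H^i_A$ is $G$-graded local cohomology, and $\mathrm{reg}_{A,\mathcal{C}}(M)=\{\mathbf{m}\in G:\mathbf{m}+\mathbb{N}\mathcal{C}[1-i]\subseteq\mathcal{Z}^i_A(M)\ \forall i\ge0\}$. Finally $$\mathrm{reg}_{B_*,\mathcal{C}}(M)=\{\mathbf{m}\in G:\ \mathbf{m}+\mathbb{N}\mathcal{C}[1-i]\subseteq\mathcal{Z}^{i+\#I-1}_{B_I}(M)\ \text{for all }i\ge0\text{ and all }\emptyset\ne I\subseteq[t]\}.$$ *)

(* Defs.v *)
From mathcomp Require Import all_boot all_order all_algebra.
From mathcomp Require Import mpoly.

Set Implicit Arguments.
Unset Strict Implicit.
Unset Printing Implicit Defensive.

Import GRing.Theory.
Local Open Scope ring_scope.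

(* Ideals are Prop-valued predicates rather than [{pred A}], because membership
   in an ideal of an arbitrary commutative ring need not be decidable. *)
Section Ideals.
Variable A : comNzRingType.

Definition ideal (I : A -> Prop) : Prop :=
  [/\ I 0,
      forall x y, I x -> I y -> I (x + y)
    & forall a x, I x -> I (a * x)].

Definition ideal_gen (X : A -> Prop) (x : A) : Prop :=
  exists2 s : seq (A * A),
    (forall u, u \in s -> X u.2) & x = \sum_(u <- s) u.1 * u.2.

Definition noetherian : Prop :=
  forall I : A -> Prop, ideal I ->
  exists s : seq A, forall x, I x <-> ideal_gen (fun y => y \in s) x.

Definition prime_ideal (P : A -> Prop) : Prop :=
  [/\ ideal P, ~ P 1 & forall x y, P (x * y) -> P x \/ P y].

Definition in_V (I P : A -> Prop) : Prop :=
  prime_ideal P /\ (forall x, I x -> P x).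

Definition ideal_pow (I : A -> Prop) (k : nat) : A -> Prop :=
  ideal_gen (fun y => exists2 a : 'I_k -> A, (forall j, I (a j)) & y = \prod_j a j).

Definition ideal_sum (t : nat) (Bs : 'I_t -> A -> Prop) (I : {set 'I_t}) (x : A)
    : Prop :=
  exists2 b : 'I_t -> A, (forall i, i \in I -> Bs i (b i)) & x = \sum_(i in I) b i.

End Ideals.

Definition monomial_ideal (R : comNzRingType) (n : nat)
    (I : {mpoly R[n]} -> Prop) : Prop :=
  exists X : 'X_{1..n} -> Prop,
    forall f, I f <-> ideal_gen (fun g => exists2 m, X m & g = 'X_[m]) f.

Definition fin_gen_group (G : zmodType) : Prop :=
  exists s : seq G, forall g : G,
  exists a : 'I_(size s) -> int, g = \sum_(i < size s) s`_i *~ a i.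

(* A G-grading of S = R[x_1, ..., x_n] with R in degree 0 and every x_i
   homogeneous is the same thing as the family [deg] of the degrees of the x_i. *)
Section GradedModules.
Variables (R : comNzRingType) (G : zmodType) (n : nat) (deg : 'I_n -> G).
Local Notation S := {mpoly R[n]}.

Definition deg_mnm (m : 'X_{1..n}) : G := \sum_(i < n) deg i *+ m i.

Definition poly_homog (g : G) (f : S) : Prop :=
  forall m, m \in msupp f -> deg_mnm m = g.

(* [in_deg g x] means that x lies in the degree g component. The last two fields
   say that the module is the direct sum of its components. *)
Record gmod := GMod {
  gmod_sort :> lmodType S;
  in_deg : G -> gmod_sort -> Prop;
  in_deg0 : forall g, in_deg g 0;
  in_degB : forall g x y, in_deg g x -> in_deg g y -> in_deg g (x - y);
  in_degZ : forall g h f x,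
    poly_homog g f -> in_deg h x -> in_deg (g + h) (f *: x);
  in_deg_span : forall x, exists s : seq G, exists2 c : G -> gmod_sort,
    (forall g, in_deg g (c g)) & x = \sum_(g <- s) c g;
  in_deg_direct : forall (s : seq G) (c : G -> gmod_sort), uniq s ->
    (forall g, in_deg g (c g)) -> \sum_(g <- s) c g = 0 ->
    forall g, g \in s -> c g = 0
}.

Definition graded_hom (E F : gmod) (f : {linear E -> F}) : Prop :=
  forall g x, in_deg g x -> in_deg g (f x).

(* Injective objects of the category of G-graded S-modules and degree 0 maps. *)
Definition graded_injective (E : gmod) : Prop :=
  forall (N N' : gmod) (j : {linear N -> N'}) (f : {linear N -> E}),
    graded_hom j -> injective j -> graded_hom f ->
  exists2 h : {linear N' -> E}, graded_hom h & forall x, h (j x) = f x.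

(* 0 -> M -> E_0 -> E_1 -> ... exact, with each E_i graded injective. *)
Record graded_injective_resolution (M : gmod) := InjRes {
  res_obj : nat -> gmod;
  res_aug : {linear M -> res_obj 0%N};
  res_d : forall i, {linear res_obj i -> res_obj i.+1};
  res_injective : forall i, graded_injective (res_obj i);
  res_aug_hom : graded_hom res_aug;
  res_d_hom : forall i, graded_hom (res_d i);
  res_aug_inj : injective res_aug;
  res_exact0 : forall x, res_d 0%N x = 0 <-> exists y, x = res_aug y;
  res_exactS : forall i x, res_d i.+1 x = 0 <-> exists y, x = res_d i y
}.

Definition torsion (A : S -> Prop) (E : gmod) (x : E) : Prop :=
  exists k : nat, forall f, ideal_pow A k f -> f *: x = 0.

Definition torsion_cocycle (A : S -> Prop) (M : gmod)
    (E : graded_injective_resolution M) (i : nat) (p : G) (x : res_obj E i) : Prop :=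
  [/\ in_deg p x, torsion A x & res_d E i x = 0].

Definition torsion_coboundary (A : S -> Prop) (M : gmod)
    (E : graded_injective_resolution M) (i : nat) (p : G) :
    res_obj E i -> Prop :=
  match i return res_obj E i -> Prop with
  | 0%N => fun x => x = 0
  | j.+1 => fun x =>
      exists y : res_obj E j, [/\ in_deg p y, torsion A y & x = res_d E j y]
  end.

(* H^i_A is the i-th right derived functor of the A-torsion functor on G-graded
   S-modules, so H^i_A(M)_p is the degree p part of the i-th cohomology of the
   A-torsion of a graded injective resolution of M. Such resolutions exist and
   the result does not depend on the one chosen. *)
Definition local_cohomology_vanishes (A : S -> Prop) (i : nat) (M : gmod) (p : G)
    : Prop :=
  forall (E : graded_injective_resolution M) (x : res_obj E i),
    torsion_cocycle A p x -> torsion_coboundary A p x.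

Definition Zset (A : S -> Prop) (i : nat) (M : gmod) : G -> Prop :=
  local_cohomology_vanishes A i M.

Section Regularity.
Variables (l : nat) (c : 'I_l -> G).

Definition NC (g : G) : Prop :=
  exists w : 'I_l -> nat, g = \sum_i c i *+ w i.

Definition NCshift (j : int) (g : G) : Prop :=
  exists w : 'I_l -> nat, (\sum_i w i)%N = `|j|%N /\
  exists2 u, NC u & g = (\sum_i c i *+ w i) *~ sgz j + u.

Definition reg (A : S -> Prop) (M : gmod) (m : G) : Prop :=
  forall i : nat, forall g, NCshift (1 - i%:Z) g -> Zset A i M (m + g).

(* [(i + #|I|).-1] is i + #I - 1, no truncation occurring as I is nonempty. *)
Definition reg_family (t : nat) (Bs : 'I_t -> S -> Prop) (M : gmod) (m : G)
    : Prop :=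
  forall (i : nat) (I : {set 'I_t}), I != set0 ->
  forall g, NCshift (1 - i%:Z) g -> Zset (ideal_sum Bs I) (i + #|I|).-1 M (m + g).

End Regularity.
End GradedModules.

(* Main.v *)
(* Up to radical, a monomial ideal A is the set U_A of supports of its monomials,
   an upward closed family of subsets of [n], and x is A-torsion iff for each T in
   U_A a power of the product of the x_i, i in T, kills x. Evaluating at 0/1
   vectors modulo a prime of R gives primes of S which show that the hypothesis on
   V(B) says U_B is the intersection of the U_{B_i}; likewise a sum of ideals
   corresponds to the union of the families.
   On a graded injective E, an element killed by the intersection of monomial
   ideals J and K is a sum of one killed by J and one killed by K. Hence the torsion
   subcomplexes of an injective resolution satisfy a Mayer-Vietoris property:
   in a fixed degree, vanishing of H^i for A and A' and of H^(i+1) for A + A'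
   gives vanishing of H^i for the intersection of A and A'. Induction on the
   number of ideals, with an auxiliary ideal W added to all of them, replaces the
   Mayer-Vietoris spectral sequence. *)
Require Import Defs.
From HB Require Import structures.
From mathcomp Require Import all_boot all_order all_algebra.
From mathcomp Require Import mpoly.
From mathcomp Require boolp classical_sets.

Set Implicit Arguments.
Unset Strict Implicit.
Unset Printing Implicit Defensive.

Import GRing.Theory.
Local Open Scope ring_scope.

(** * Existence of a prime ideal in a nonzero commutative ring *)

Section PrimeExistence.
Variable A : comNzRingType.

(* Zorn's lemma is applied to additively closed absorbing sets, not to ideals,
   so that the union of the empty chain is allowed. *)
Lemma exists_prime_ideal : exists P : A -> Prop, prime_ideal P.
Proof.
pose proper_ideal (I : A -> Prop) :=
  [/\ forall x y, I x -> I y -> I (x + y), forall a x, I x -> I (a * x) & ~ I 1].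
have [F Fproper Fchain|P [[PD PM P1] Pmax]] := @classical_sets.Zorn_bigcup A proper_ideal.
  split=> [x y [I FI Ix] [J FJ Jy]|a x [I FI Ix]|[I FI I1]].
  - have [IJ|JI] := Fchain _ _ FI FJ.
    + by exists J => //; have [JD _ _] := Fproper _ FJ; apply: JD => //; apply: IJ.
    + by exists I => //; have [ID _ _] := Fproper _ FI; apply: ID => //; apply: JI.
  - by exists I => //; have [_ IM _] := Fproper _ FI; apply: IM.
  - by have [_ _] := Fproper _ FI; apply.
(* Maximality of [P] is used here. The alternative [u = 0] covers the case of an empty [P], not yet
   excluded. *)
have Pcomax x : ~ P x -> exists u a, (P u \/ u = 0) /\ u + a * x = 1.
  move=> Px; apply: boolp.contrapT => noPx.
  pose Q z := exists u a, (P u \/ u = 0) /\ z = u + a * x.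
  apply: (Pmax Q); first split.
  - by move=> u Pu; exists u, 0; split; [left | rewrite mul0r addr0].
  - move=> QP; apply: Px; apply: QP; exists 0, 1; split; first by right.
    by rewrite add0r mul1r.
  - split=> [_ _ [u [a [Pu ->]]] [v [b [Pv ->]]]|b _ [u [a [Pu ->]]]|[u [a [Pu e]]]].
    + exists (u + v), (a + b); split; last by rewrite mulrDl addrACA.
      case: Pu Pv => [Pu|->] [Pv|->]; rewrite ?addr0 ?add0r; try by left.
        by left; apply: PD.
      by right.
    + exists (b * u), (b * a); split; last by rewrite mulrDr mulrA.
      by case: Pu => [Pu|->]; [left; apply: PM | right; rewrite mulr0].
    + by apply: noPx; exists u, a.
have P0 : P 0.
  apply: boolp.contrapT => /Pcomax[u [a [Pu]]]; rewrite mulr0 addr0 => u1.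
  by case: Pu; rewrite u1 // => /eqP; rewrite oner_eq0.
exists P; split=> // x y Pxy; apply: boolp.contrapT => nPxy.
have /Pcomax[u [a [Pu eu]]] : ~ P x by move=> Px; apply: nPxy; left.
have /Pcomax[v [b [Pv ev]]] : ~ P y by move=> Py; apply: nPxy; right.
have {}Pu : P u by case: Pu => // ->.
have {}Pv : P v by case: Pv => // ->.
(* Expand 1 = (u + a x)(v + b y): each term has a factor u, v or x y in [P]. *)
apply: P1; rewrite -(mulr1 1) -{1}eu -ev mulrDl; apply: (PD).
  by rewrite mulrC; apply: PM.
rewrite mulrDr; apply: PD; first exact: PM.
by rewrite mulrACA; apply: PM.
Qed.

End PrimeExistence.

(** * Polynomials supported on a set of monomials *)

Section MonomialSupports.
Variables (R : comNzRingType) (n : nat).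
Local Notation S := {mpoly R[n]}.
Implicit Types (f g : S) (T : {set 'I_n}) (U V : {set {set 'I_n}}).

Definition mnm_supp (m : 'X_{1..n}) : {set 'I_n} := [set i | m i != 0%N].
Definition set_mnm T (N : nat) : 'X_{1..n} :=
  [multinom (if i \in T then N else 0)%N | i < n].
Definition upclosed (q : pred 'X_{1..n}) : Prop :=
  forall m1 m2, q m2 -> q (m1 + m2)%MM.
Definition supported (q : pred 'X_{1..n}) : pred S := fun f => all q (msupp f).
Definition upset U : Prop := forall T T', T \in U -> T \subset T' -> T' \in U.

Lemma supportedP (q : pred 'X_{1..n}) f :
  reflect (forall m, ~~ q m -> f@_m = 0) (supported q f).
Proof.
apply: (iffP allP) => fq m.
  by move=> qm; apply: memN_msupp_eq0; apply: contra qm => /fq.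
by rewrite mcoeff_msupp; apply: contraNT => /fq ->.
Qed.

Lemma supported0 (q : pred 'X_{1..n}) : supported q 0.
Proof. by apply/supportedP => m _; rewrite mcoeff0. Qed.

Lemma supportedD (q : pred 'X_{1..n}) f g :
  supported q f -> supported q g -> supported q (f + g).
Proof.
move=> /supportedP fq /supportedP gq; apply/supportedP => m qm.
by rewrite mcoeffD fq // gq // addr0.
Qed.

Lemma supportedM (q : pred 'X_{1..n}) f g :
  upclosed q -> supported q g -> supported q (f * g).
Proof.
move=> q_up /allP gq; apply/allP => m /msuppM_le /allpairsP[[m1 m2] /= [_ m2g ->]].
exact/q_up/gq.
Qed.

Definition mono_proj (q : pred 'X_{1..n}) f : S :=
  \sum_(m <- msupp f) (if q m then f@_m else 0) *: 'X_[m].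

Lemma mcoeff_proj q f m : (mono_proj q f)@_m = if q m then f@_m else 0.
Proof.
rewrite raddf_sum /=; have [mf|mf] := boolP (m \in msupp f); last first.
  rewrite (memN_msupp_eq0 mf) if_same big1_seq // => m' /andP[_ m'f].
  rewrite mcoeffZ mcoeffX; case: eqP => [e|_]; last by rewrite mulr0.
  by rewrite -e m'f in mf.
rewrite (bigD1_seq m) //= ?msupp_uniq // mcoeffZ mcoeffX eqxx mulr1 big1 ?addr0 //.
by move=> m' /negPf m'm; rewrite mcoeffZ mcoeffX m'm mulr0.
Qed.

Lemma mono_projD q f g : mono_proj q (f + g) = mono_proj q f + mono_proj q g.
Proof.
apply/mpolyP => m; rewrite mcoeffD !mcoeff_proj mcoeffD.
by case: ifP => //; rewrite addr0.
Qed.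

Lemma mono_projC q f : mono_proj q f + mono_proj (fun m => ~~ q m) f = f.
Proof.
apply/mpolyP => m; rewrite mcoeffD !mcoeff_proj.
by case: (q m); rewrite ?addr0 ?add0r.
Qed.

Lemma mono_proj_id (q : pred 'X_{1..n}) f : supported q f -> mono_proj q f = f.
Proof.
move=> /supportedP fq; apply/mpolyP => m; rewrite mcoeff_proj.
by case: ifP => // /negbT/fq ->.
Qed.

Lemma mono_projC_id (q : pred 'X_{1..n}) f :
  supported q f -> mono_proj (fun m => ~~ q m) f = 0.
Proof. by move=> fq; apply: (addrI f); rewrite -{1}(mono_proj_id fq) mono_projC addr0. Qed.

End MonomialSupports.

(** * Monomial ideals as graded modules *)

Section MonomialSubmodule.
Variables (R : comNzRingType) (n : nat).
Local Notation S := {mpoly R[n]}.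

(** Bundling the closure proof with the predicate lets the module structure of [mono_submod] be
    inferred from [q]. *)
Record mono_upset := MonoUpset {
  mono_in :> pred 'X_{1..n}; mono_up : upclosed mono_in }.

Variable q : mono_upset.

(* S^o, not S, carries the S-module structure of S. *)
Definition mono_supported : pred S^o := supported (R := R) q.
Fact mono_submod_closed : submod_closed mono_supported.
Proof.
split; first exact: supported0.
move=> a f g fq gq; apply: supportedD => //.
exact: (supportedM a (@mono_up q)).
Qed.
HB.instance Definition _ := GRing.isSubmodClosed.Build S S^o mono_supported
  mono_submod_closed.

Record mono_submod := MonoSubmod { mono_val :> S^o; _ : mono_val \in mono_supported }.
HB.instance Definition _ := [isSub for mono_val].
HB.instance Definition _ := [Choice of mono_submod by <:].
HB.instance Definition _ := [SubChoice_isSubLmodule of mono_submod by <:].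

Lemma mono_submodP (f : mono_submod) : supported q (mono_val f).
Proof. exact: valP f. Qed.

End MonomialSubmodule.

Lemma linear_map_of (A : pzRingType) (U V : lmodType A) (f : U -> V) :
  linear f -> exists F : {linear U -> V}, F =1 f.
Proof.
move=> f_lin; pose fL := GRing.isLinear.Build A U V *:%R f f_lin.
pose F : {linear U -> V} := HB.pack f fL.
by exists F.
Qed.

Section MonomialGradedModule.
Variables (R : comNzRingType) (G : zmodType) (n : nat) (deg : 'I_n -> G).
Local Notation S := {mpoly R[n]}.

Lemma poly_homogP g (f : S) :
  poly_homog deg g f <-> (forall m, deg_mnm deg m <> g -> f@_m = 0).
Proof.
split=> fg m => [mg|]; first by apply: memN_msupp_eq0; apply/negP => /fg.
rewrite mcoeff_msupp => fm; have [//|/eqP mg] := eqVneq (deg_mnm deg m) g.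
by rewrite fg ?eqxx in fm.
Qed.

Lemma deg_mnmD m1 m2 :
  deg_mnm deg (m1 + m2)%MM = deg_mnm deg m1 + deg_mnm deg m2.
Proof. by rewrite -big_split /=; apply: eq_bigr => i _; rewrite mnmDE mulrnDr. Qed.

Variables (q : mono_upset n) (p : G).
Local Notation N := (mono_submod R q).

(* The degrees are shifted so that 1 has degree p. *)
Definition mono_in_deg (g : G) (f : N) : Prop := poly_homog deg (g - p) (mono_val f).

Fact mono_in_deg0 g : mono_in_deg g 0.
Proof. by apply/poly_homogP => m _; rewrite mcoeff0. Qed.

Fact mono_in_degB g x y :
  mono_in_deg g x -> mono_in_deg g y -> mono_in_deg g (x - y).
Proof.
move=> /poly_homogP xg /poly_homogP yg; apply/poly_homogP => m mg.
by rewrite mcoeffB xg // yg // subr0.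
Qed.

Fact mono_in_degZ g h f x :
  poly_homog deg g f -> mono_in_deg h x -> mono_in_deg (g + h) (f *: x).
Proof.
move=> fg xh m mfx; have {mfx} : m \in msupp (f * mono_val x : S) by [].
case/msuppM_le/allpairsP=> [[m1 m2] /= [m1f m2x ->]].
by rewrite deg_mnmD (fg _ m1f) (xh _ m2x) addrA.
Qed.

Fact mono_component_subproof g (x : N) :
  mono_proj (fun m => deg_mnm deg m + p == g) (mono_val x) \in mono_supported (R := R) q.
Proof.
apply/supportedP => m qm; rewrite mcoeff_proj.
by have /supportedP -> := mono_submodP x; rewrite ?if_same.
Qed.
Definition mono_component x g : N := MonoSubmod (mono_component_subproof g x).

Fact mono_in_deg_span x : exists s : seq G, exists2 c : G -> N,
  (forall g, mono_in_deg g (c g)) & x = \sum_(g <- s) c g.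
Proof.
(* Distinct monomials may share a degree, whose component must be counted once. *)
exists (undup [seq deg_mnm deg m + p | m <- msupp (mono_val x)]).
exists (mono_component x) => [g|].
  apply/poly_homogP => m mg /=; rewrite mcoeff_proj; case: eqP => // e.
  by case: mg; rewrite -e addrK.
apply: val_inj; rewrite raddf_sum /=; apply/mpolyP => m; rewrite raddf_sum /=.
under eq_bigr do rewrite mcoeff_proj.
have [mx|mx] := boolP (m \in msupp (mono_val x)); last first.
  by rewrite memN_msupp_eq0 // big1 // => g _; rewrite if_same.
rewrite (bigD1_seq (deg_mnm deg m + p)) ?undup_uniq //=; last first.
  by rewrite mem_undup; apply: (map_f (fun m => deg_mnm deg m + p)).
by rewrite eqxx big1 ?addr0 // => g /negPf; rewrite eq_sym => ->.
Qed.

Fact mono_in_deg_direct (s : seq G) (c : G -> N) : uniq s ->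
  (forall g, mono_in_deg g (c g)) -> \sum_(g <- s) c g = 0 ->
  forall g, g \in s -> c g = 0.
Proof.
move=> s_uniq cdeg sum0 g gs; apply: val_inj => /=; apply/mpolyP => m.
rewrite mcoeff0; have [mg|/eqP mg] := eqVneq (deg_mnm deg m) (g - p); last first.
  by have /poly_homogP := cdeg g; apply.
have := congr1 (fun x : N => (val x : S)@_m) sum0.
rewrite [val _]raddf_sum raddf_sum /= mcoeff0 (bigD1_seq g) //= big1 ?addr0 // => h hg.
have /poly_homogP := cdeg h; apply; rewrite mg => /addIr gh.
by rewrite gh eqxx in hg.
Qed.

Definition mono_gmod : gmod R deg :=
  GMod mono_in_deg0 mono_in_degB mono_in_degZ mono_in_deg_span mono_in_deg_direct.

End MonomialGradedModule.

(** * Splitting elements of graded injective modules *)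

Section Splitting.
Variables (R : comNzRingType) (G : zmodType) (n : nat) (deg : 'I_n -> G).
Local Notation S := {mpoly R[n]}.

Fact mono_all_up : upclosed (n := n) xpredT. Proof. by []. Qed.
Definition mono_all : mono_upset n := MonoUpset mono_all_up.

Lemma supported_mono_all (f : S) : f \in mono_supported (R := R) mono_all.
Proof. by apply/allP. Qed.

Fact mono_union_up (J K : mono_upset n) : upclosed (fun m => J m || K m).
Proof. by move=> m1 m2 /orP[/mono_up->|/mono_up->] //; rewrite orbT. Qed.
Definition mono_union J K : mono_upset n := MonoUpset (@mono_union_up J K).

(* The element y is the image of 1 under an extension to S of the map
   J + K -> E that is 0 on J and multiplication by x on K. *)
Lemma graded_injective_split (E : gmod R deg) (J K : mono_upset n) p (x : E) :
    graded_injective E -> in_deg p x ->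
    (forall f : S, supported (fun m => J m && K m) f -> f *: x = 0) ->
  exists y : E, [/\ in_deg p y, forall f : S, supported J f -> f *: y = 0
    & forall f : S, supported K f -> f *: y = f *: x].
Proof.
move=> Einj xp JKx.
pose nJ m := ~~ J m.
pose N := mono_gmod R deg (mono_union J K) p.
pose N' := mono_gmod R deg mono_all p.
have [j jE] : exists j : {linear N -> N'},
    j =1 fun f : N => MonoSubmod (supported_mono_all (mono_val f)).
  by apply: linear_map_of => a f g; apply: val_inj.
(* For f in J + K, the part of f outside [J] lies in [K] and differs from f by an element of [J]. *)
have [h hE] : exists h : {linear N -> E},
    h =1 fun f : N => mono_proj nJ (mono_val f) *: x.
  apply: linear_map_of => a f g /=.
  rewrite mono_projD scalerDl; congr (_ + _); rewrite scalerA.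
  set u : S := mono_val f; have uJK : supported (fun m => J m || K m) u.
    exact: mono_submodP.
  apply/eqP; rewrite eq_sym -subr_eq0 -scalerBl; apply/eqP/JKx.
  (* The defect of linearity is the [J] part of an element of [K], so it lies in both ideals and
     kills x. *)
  have -> : a * mono_proj nJ u - mono_proj nJ (a * u)
          = mono_proj J (a * mono_proj nJ u).
    rewrite -{2}(mono_projC J u) mulrDr mono_projD -/nJ.
    have -> : mono_proj nJ (a * mono_proj J u) = 0.
      apply: mono_projC_id; apply: supportedM; first exact: mono_up.
      apply/supportedP => m Jm; rewrite mcoeff_proj.
      by rewrite (negPf Jm).
    by apply/eqP; rewrite add0r subr_eq mono_projC.
  have aK : supported K (a * mono_proj nJ u).
    apply: supportedM; first exact: mono_up.
    apply/supportedP => m Km; rewrite mcoeff_proj /nJ.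
    case: ifP => // Jm; move/supportedP: uJK; apply.
    by rewrite negb_or Jm.
  apply/supportedP => m; rewrite mcoeff_proj negb_and.
  case/orP => [/negPf -> //|Km]; move/supportedP: aK => ->//.
  by rewrite if_same.
have [|||H Hhom HE] := Einj N N' j h.
- by move=> g f fg; rewrite jE.
- by move=> f g; rewrite !jE => /(congr1 (@mono_val _ _ _)) /= /val_inj.
- move=> g f fg; rewrite hE -[g](subrK p); apply: in_degZ xp.
  apply/poly_homogP => m mg; rewrite mcoeff_proj.
  by have /poly_homogP -> := fg; rewrite ?if_same.
pose one : N' := MonoSubmod (supported_mono_all 1).
have HoneE (f : S) : supported (mono_union J K) f ->
    f *: H one = mono_proj nJ f *: x.
  move=> fJK; rewrite -linearZ /=.
  have -> : f *: one = j (MonoSubmod fJK : N).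
    by rewrite jE; apply: val_inj => /=; apply: mulr1.
  by rewrite HE hE.
exists (H one); split=> [|f fJ|f fK].
- apply: Hhom; apply/poly_homogP => m mp /=; rewrite mcoeff1.
  case: eqP => // m0; case: mp; rewrite m0 subrr.
  by rewrite /deg_mnm big1 // => i _; rewrite mnm0E.
- rewrite HoneE; first by rewrite mono_projC_id // scale0r.
  by apply/allP => m /(allP fJ) /= ->.
- rewrite HoneE; last by apply/allP => m /(allP fK) /= ->; rewrite orbT.
  (* As f lies in [K], its [J] part lies in both ideals and kills x. *)
  rewrite -{2}(mono_projC J f) scalerDl [X in X + _]JKx ?add0r //.
  apply/supportedP => m; rewrite mcoeff_proj negb_and.
  by case/orP => [/negPf ->//|Km]; move/supportedP: fK => ->//; rewrite if_same.
Qed.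

End Splitting.

(** * Torsion in terms of supports *)

Section SupportTorsion.
Variables (R : comNzRingType) (n : nat).
Local Notation S := {mpoly R[n]}.
Implicit Types (T : {set 'I_n}) (U V : {set {set 'I_n}}) (E : lmodType S).

Lemma set_mnmD T N M : set_mnm T (N + M) = (set_mnm T N + set_mnm T M)%MM.
Proof. by apply/mnmP => i; rewrite mnmDE !mnmE; case: ifP. Qed.

Lemma set_mnm0 T : set_mnm T 0 = 0%MM.
Proof. by apply/mnmP => i; rewrite mnmE mnm0E if_same. Qed.

Lemma set_mnm_scale_le E (x : E) T N M : (N <= M)%N ->
  'X_[set_mnm T N] *: x = 0 -> 'X_[set_mnm T M] *: x = 0.
Proof.
by move=> /subnK <- x0; rewrite set_mnmD mpolyXD -scalerA x0 scaler0.
Qed.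

Lemma supported_scale0 E (x : E) (q : pred 'X_{1..n}) (f : S) :
  (forall m, q m -> 'X_[m] *: x = 0) -> supported q f -> f *: x = 0.
Proof.
move=> qx /allP fq; rewrite [f]mpolyE scaler_suml big1_seq // => m /andP[_ mf].
by rewrite -mul_mpolyC -scalerA qx ?scaler0 // fq.
Qed.

Definition supp_torsion U E (x : E) : Prop :=
  forall T, T \in U -> exists N, 'X_[set_mnm T N] *: x = 0.

Lemma supp_torsion0 U E : supp_torsion U (0 : E).
Proof. by move=> T _; exists 0%N; rewrite scaler0. Qed.

Lemma supp_torsionD U E (x y : E) :
  supp_torsion U x -> supp_torsion U y -> supp_torsion U (x + y).
Proof.
move=> xU yU T TU; have [N xN] := xU T TU; have [M yM] := yU T TU.
exists (maxn N M); rewrite scalerDr.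
by rewrite (set_mnm_scale_le _ xN) ?leq_maxl // (set_mnm_scale_le _ yM) ?leq_maxr // addr0.
Qed.

Lemma supp_torsionN U E (x : E) : supp_torsion U x -> supp_torsion U (- x).
Proof.
by move=> xU T TU; have [N xN] := xU T TU; exists N; rewrite scalerN xN oppr0.
Qed.

Lemma supp_torsion_linear U E (F : lmodType S) (d : {linear E -> F}) x :
  supp_torsion U x -> supp_torsion U (d x).
Proof.
by move=> xU T TU; have [N xN] := xU T TU; exists N; rewrite -linearZ /= xN linear0.
Qed.

Lemma supp_torsionS U V E (x : E) :
  U \subset V -> supp_torsion V x -> supp_torsion U x.
Proof. by move=> /subsetP UV xV T /UV /xV. Qed.

Lemma supp_torsionU U V E (x : E) :
  supp_torsion U x -> supp_torsion V x -> supp_torsion (U :|: V) x.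
Proof. by move=> xU xV T /setUP[/xU|/xV]. Qed.

(** The empty support belongs to [setT], and its monomial is 1. *)
Lemma supp_torsionT E (x : E) : supp_torsion setT x -> x = 0.
Proof.
move=> /(_ set0 (in_setT _))[N].
suff -> : set_mnm set0 N = 0%MM :> 'X_{1..n} by rewrite mpolyX0 scale1r.
by apply/mnmP => i; rewrite mnmE inE mnm0E.
Qed.

Lemma supp_torsion_uniform U E (x : E) : supp_torsion U x ->
  exists N, forall T, T \in U -> 'X_[set_mnm T N] *: x = 0.
Proof.
move=> xU; have /fin_all_exists[nu nuP] :
    forall T, exists N, T \in U -> 'X_[set_mnm T N] *: x = 0.
  move=> T; have [/xU[N xN]|_] := boolP (T \in U); first by exists N.
  by exists 0%N.
exists (\max_T nu T) => T TU.
by apply: set_mnm_scale_le (nuP T TU); apply: leq_bigmax.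
Qed.

Lemma mnm_factor_set T N (m : 'X_{1..n}) : (forall i, i \in T -> (N <= m i)%N) ->
  m = (m - set_mnm T N + set_mnm T N)%MM.
Proof.
move=> Tm; apply/mnmP => i; rewrite mnmDE mnmBE mnmE.
by case: ifP => [/Tm/subnK->//|_]; rewrite subn0 addn0.
Qed.

(* Pigeonhole: some support T in U occurs more than [nu T] times among the
   supports of the factors. *)
Lemma supported_prod_scale0 U E k (nu : {set 'I_n} -> nat) (a : 'I_k -> S) (x : E) :
    (forall j, supported (fun m => mnm_supp m \in U) (a j)) ->
    (\sum_(T in U) nu T < k)%N ->
    (forall T, T \in U -> 'X_[set_mnm T (nu T)] *: x = 0) ->
  (\prod_j a j) *: x = 0.
Proof.
elim: k nu a x => [//|k IHk] nu a x aU nu_lt x0.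
rewrite big_ord_recl mulrC -scalerA.
set b := \prod_(i < k) _.
rewrite [a ord0]mpolyE scaler_suml scaler_sumr big1_seq // => m /andP[_ ma].
rewrite -mul_mpolyC -scalerA scalerA mulrC -scalerA.
suff -> : b *: ('X_[m] *: x) = 0 by rewrite scaler0.
set T := mnm_supp m; have TU : T \in U by move/allP: (aU ord0); apply.
(* If [nu T] is 0, then x itself is 0. *)
have := x0 T TU; case nuT : (nu T) => [|N] xN.
  by move: xN; rewrite set_mnm0 mpolyX0 scale1r => ->; rewrite !scaler0.
have /mnm_factor_set -> : forall i, i \in T -> (1 <= m i)%N by move=> i; rewrite inE lt0n.
rewrite mpolyXD -scalerA scalerA mulrC -scalerA.
(* Multiplying x by the product of the variables in T lowers the killing exponent at T by one, so
   the sum of exponents drops together with k. *)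
rewrite (IHk (fun T' => if T' == T then N else nu T')) ?scaler0 //.
- apply: leq_trans (_ : \sum_(T' in U) nu T' <= k)%N; last by rewrite -ltnS.
  rewrite (bigD1 T) //= [X in (_ <= X)%N](bigD1 T) //= eqxx nuT addSn ltnS leq_add2l.
  by apply: leq_sum => T' /andP[_ /negPf ->].
- move=> T' T'U; case: eqP => [->|_]; first by rewrite scalerA -mpolyXD -set_mnmD addn1.
  by rewrite scalerA mulrC -scalerA x0 ?scaler0.
Qed.

(* [U] is the set of supports of the monomials of the radical of [A]. *)
Definition supports_of (A : S -> Prop) U : Prop :=
  [/\ upset U, forall T, T \in U -> exists N, A 'X_[set_mnm T N]
    & forall f, A f -> supported (fun m => mnm_supp m \in U) f].

Lemma torsion_supports (G : zmodType) (deg : 'I_n -> G) (E : gmod R deg) A U (x : E) :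
  supports_of A U -> torsion A x <-> supp_torsion U x.
Proof.
move=> [_ XA AU]; split=> [[k Akx] T /XA[N AN]|xU].
  (* The k-th power of an element of [A] lies in the k-th power of [A]. *)
  exists (k * N)%N; apply: Akx.
  exists [:: (1, 'X_[set_mnm T (k * N)])]; last by rewrite big_seq1 mul1r.
  move=> u; rewrite inE => /eqP -> /=; exists (fun=> 'X_[set_mnm T N]) => //.
  rewrite prodr_const card_ord mpolyXn; congr 'X_[_]; apply/mnmP => i.
  rewrite mulmnE !mnmE; by case: ifP => // _; rewrite mulnC.
have [N xN] := supp_torsion_uniform xU.
(* One factor more than the sum of the exponents, as the pigeonhole argument requires. *)
exists (\sum_(T in U) N).+1 => f [s sA ->].
rewrite scaler_suml big1_seq // => u /andP[_ /sA[a aA ->]].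
by rewrite -scalerA (supported_prod_scale0 (U := U) (nu := fun=> N)) ?scaler0 // => j; apply: AU.
Qed.

(** These are the monomials of the ideal generated by the N-th powers of the squarefree monomials
    with support in [U]. *)
Definition mult_of U N (m : 'X_{1..n}) : bool :=
  [exists T in U, [forall i in T, N <= m i]%N].

Lemma mult_of_up U N : upclosed (mult_of U N).
Proof.
move=> m1 m2 /existsP[T /andP[TU /forallP Tm]]; apply/existsP; exists T.
rewrite TU; apply/forallP => i; apply/implyP => iT.
by rewrite mnmDE (leq_trans (implyP (Tm i) iT)) // leq_addl.
Qed.

Lemma mult_of_scale0 U N E (x : E) m :
  (forall T, T \in U -> 'X_[set_mnm T N] *: x = 0) -> mult_of U N m ->
  'X_[m] *: x = 0.
Proof.
move=> xU /existsP[T /andP[TU /forall_inP Tm]].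
by rewrite (mnm_factor_set Tm) mpolyXD -scalerA xU ?scaler0.
Qed.

(** The union of the two witnessing supports lies in both families by upward closure. *)
Lemma mult_ofI U V N m : upset U -> upset V ->
  mult_of U N m -> mult_of V N m -> mult_of (U :&: V) N m.
Proof.
move=> Uup Vup /existsP[T /andP[TU /forall_inP Tm]] /existsP[T' /andP[T'V /forall_inP T'm]].
apply/existsP; exists (T :|: T'); apply/andP; split.
  by apply/setIP; split; [apply: Uup TU _; apply: subsetUl
                         |apply: Vup T'V _; apply: subsetUr].
by apply/forall_inP => i /setUP[/Tm|/T'm].
Qed.

Lemma supported_mult_of U T N :
  T \in U -> supported (mult_of U N) ('X_[set_mnm T N] : S).
Proof.
move=> TU; rewrite /supported msuppX /= andbT; apply/existsP; exists T.
by rewrite TU; apply/forall_inP => i iT; rewrite mnmE iT.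
Qed.

(** With N a uniform exponent for x, the ideals of [mult_of U N] and [mult_of V N] have an
    intersection that kills x; then y is killed by the first and x - y by the second. *)
Lemma supp_torsion_split (G : zmodType) (deg : 'I_n -> G) (E : gmod R deg) U V p (x : E) :
    graded_injective E -> upset U -> upset V -> in_deg p x ->
    supp_torsion (U :&: V) x ->
  exists y z : E, [/\ in_deg p y, in_deg p z, supp_torsion U y, supp_torsion V z
    & x = y + z].
Proof.
move=> Einj Uup Vup xp /supp_torsion_uniform[N xN].
have [|y [yp yU yV]] := @graded_injective_split R G n deg E
    (MonoUpset (@mult_of_up U N)) (MonoUpset (@mult_of_up V N)) p x Einj xp.
  move=> f; apply: supported_scale0 => m /andP[mU mV].
  exact: mult_of_scale0 xN (mult_ofI Uup Vup mU mV).
exists y, (x - y); split=> //; last by rewrite addrC subrK.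
- exact: in_degB.
- by move=> T TU; exists N; apply: yU; apply: supported_mult_of.
- move=> T TV; exists N; apply/eqP; rewrite scalerBr subr_eq0 eq_sym; apply/eqP.
  by apply: yV; apply: supported_mult_of.
Qed.

Lemma upsetU U V : upset U -> upset V -> upset (U :|: V).
Proof.
by move=> Uup Vup T T' /setUP[/Uup h|/Vup h] /h; rewrite inE => ->; rewrite ?orbT.
Qed.

Lemma upsetI U V : upset U -> upset V -> upset (U :&: V).
Proof.
move=> Uup Vup T T' /setIP[TU TV] TT'; apply/setIP; split.
  exact: Uup TU TT'.
exact: Vup TV TT'.
Qed.

End SupportTorsion.

(** * Mayer-Vietoris induction over families of supports *)

Section MayerVietoris.
Variables (R : comNzRingType) (G : zmodType) (n : nat) (deg : 'I_n -> G).
Variables (M : gmod R deg) (E : graded_injective_resolution M) (p : G).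
Implicit Types (T : {set 'I_n}) (U V W : {set {set 'I_n}}).

Definition supp_coboundary U i : res_obj E i -> Prop :=
  match i return res_obj E i -> Prop with
  | 0%N => fun x => x = 0
  | j.+1 => fun x =>
      exists y : res_obj E j, [/\ in_deg p y, supp_torsion U y & x = res_d E j y]
  end.

(** Vanishing, in degree [p], of the i-th cohomology of the torsion subcomplex. *)
Definition supp_acyclic U i : Prop := forall x : res_obj E i,
  in_deg p x -> supp_torsion U x -> res_d E i x = 0 -> supp_coboundary U x.

Lemma in_degD (F : gmod R deg) g (x y : F) : in_deg g x -> in_deg g y -> in_deg g (x + y).
Proof.
move=> xg yg; rewrite -[y]opprK -[- y]sub0r; apply: in_degB => //.
by apply: in_degB => //; apply: in_deg0.
Qed.

Lemma supp_coboundaryD U V i (x y : res_obj E i) :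
  supp_coboundary U x -> supp_coboundary V y -> supp_coboundary (U :&: V) (x + y).
Proof.
case: i x y => [|i] x y /=; first by move=> -> ->; rewrite addr0.
move=> [u [up uU ->]] [v [vp vV ->]]; exists (u + v); split.
- exact: in_degD.
- apply: supp_torsionD.
    by apply: supp_torsionS uU; apply: subsetIl.
  by apply: supp_torsionS vV; apply: subsetIr.
- by rewrite linearD.
Qed.

Lemma res_dd i (x : res_obj E i) : res_d E i.+1 (res_d E i x) = 0.
Proof. by apply/res_exactS; exists x. Qed.

(** Split x = y + z into torsion elements for [U] and [V]. Then d y = - d z is torsion for both, so
    d y = d w with w torsion for the union, and x is the sum of the cocycles y - w and z + w. *)
Lemma mayer_vietoris U V i : upset U -> upset V ->
  supp_acyclic U i -> supp_acyclic V i -> supp_acyclic (U :|: V) i.+1 ->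
  supp_acyclic (U :&: V) i.
Proof.
move=> Uup Vup HU HV HUV x xp xUV dx.
have [y [z [yp zp yU zV xE]]] :=
  supp_torsion_split (@res_injective _ _ _ _ _ E i) Uup Vup xp xUV.
have dyz : res_d E i y = - res_d E i z.
  by apply/eqP; rewrite -addr_eq0 -linearD /= -xE dx.
have [||w [wp wUV dyw]] := HUV (res_d E i y) (res_d_hom yp).
- apply: supp_torsionU; first exact: supp_torsion_linear.
  by rewrite dyz; apply/supp_torsionN/supp_torsion_linear.
- exact: res_dd.
have wU : supp_torsion U w by apply: supp_torsionS wUV; apply: subsetUl.
have wV : supp_torsion V w by apply: supp_torsionS wUV; apply: subsetUr.
have -> : x = (y - w) + (z + w) by rewrite addrACA addNr addr0.
apply: supp_coboundaryD.
  apply: HU; first exact: in_degB.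
    by apply: supp_torsionD => //; apply: supp_torsionN.
  by rewrite linearB /= dyw subrr.
apply: HV; first exact: in_degD.
  exact: supp_torsionD.
by rewrite linearD /= -dyw dyz addrN.
Qed.

Lemma supp_acyclicT i : supp_acyclic setT i.
Proof.
move=> x _ /supp_torsionT -> _; case: i x => [|i] x //=.
by exists 0; rewrite linear0; split=> //; [apply: in_deg0 | apply: supp_torsion0].
Qed.

Variables (t : nat) (Us : 'I_t -> {set {set 'I_n}}).
Hypothesis Us_up : forall i, upset (Us i).

Lemma supp_acyclic_bigcap (s : seq 'I_t) W k : uniq s -> upset W ->
    (forall I : {set 'I_t}, I != set0 -> {subset I <= s} ->
      supp_acyclic (W :|: \bigcup_(i in I) Us i) (k + #|I|).-1) ->
  supp_acyclic (W :|: \bigcap_(i <- s) Us i) k.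
Proof.
elim: s W k => [|j s IHs] W k.
  by rewrite big_nil setUT => _ _ _; apply: supp_acyclicT.
move=> /= /andP[js s_uniq] Wup H; rewrite big_cons setUIr.
have capup : upset (\bigcap_(i <- s) Us i).
  by elim/big_ind: _ => // [T T'|U V]; [rewrite !inE | apply: upsetI].
apply: mayer_vietoris; try exact: upsetU.
- have := H [set j]; rewrite big_set1 cards1 addn1; apply.
    by apply/set0Pn; exists j; rewrite inE.
  by move=> i /set1P ->; rewrite inE eqxx.
- by apply: IHs => // I I0 Is; apply: H => // i /Is; rewrite inE orbC => ->.
(* Third term of Mayer-Vietoris: induct with [W :|: Us j] in degree k + 1. The raised degree matches
   the extra element of [j |: I]. *)
rewrite setUACA setUid setUA.
apply: IHs => // [|I I0 Is]; first exact: upsetU.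
have jI : j \notin I by apply: contra js => /Is.
have := H (j |: I); rewrite big_setU1 // cardsU1 jI setUA add1n addnS; apply.
  by apply/set0Pn; exists j; rewrite !inE eqxx.
by move=> i; rewrite !inE => /orP[->//|/Is ->]; rewrite orbT.
Qed.

End MayerVietoris.

(** * Supports of monomial ideals, of their sums, and primes at 0/1 vectors *)

Section SupportsOfMonomialIdeals.
Variables (R : comNzRingType) (n : nat).
Local Notation S := {mpoly R[n]}.
Implicit Types (A : S -> Prop) (T : {set 'I_n}) (U V : {set {set 'I_n}}).

Lemma upclosed_supp U : upset U -> upclosed (fun m => mnm_supp m \in U).
Proof.
move=> Uup m1 m2 mU; apply: Uup mU _; apply/subsetP => i.
by rewrite !inE mnmDE addn_eq0 negb_and => ->; rewrite orbT.
Qed.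

Lemma supported_sum (I : Type) (s : seq I) (P : pred I) (F : I -> S) q :
  (forall i, P i -> supported q (F i)) -> supported q (\sum_(i <- s | P i) F i).
Proof.
move=> Fq; elim/big_ind: _ => //; first exact: supported0.
exact: supportedD.
Qed.

Lemma supported_sum_seq (I : eqType) (s : seq I) (F : I -> S) q :
  (forall i, i \in s -> supported q (F i)) -> supported q (\sum_(i <- s) F i).
Proof. by move=> Fq; rewrite big_seq; apply: supported_sum. Qed.

Lemma monomial_ideal0 A : monomial_ideal A -> A 0.
Proof. by case=> X AE; apply/AE; exists [::]; rewrite ?big_nil. Qed.

Lemma monomial_ideal_mem A X m :
  (forall f, A f <-> ideal_gen (fun g => exists2 m, X m & g = 'X_[m]) f) ->
  X m -> A 'X_[m].
Proof.
move=> AE Xm; apply/AE; exists [:: (1, 'X_[m])]; last by rewrite big_seq1 mul1r.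
by move=> u; rewrite inE => /eqP ->; exists m.
Qed.

Lemma monomial_idealM A f g : monomial_ideal A -> A g -> A (f * g).
Proof.
case=> X AE /AE[s sX ->]; apply/AE.
exists [seq (f * u.1, u.2) | u <- s] => [_ /mapP[u us ->]|]; first exact: sX us.
by rewrite big_map big_distrr /=; apply: eq_bigr => u _; rewrite mulrA.
Qed.

(** The explicit description of U is kept beside [supports_of] because evaluation at 0/1 vectors
    tests exactly it. *)
Lemma monomial_ideal_supports A : monomial_ideal A ->
  exists U, supports_of A U /\
    forall T, T \in U <-> exists2 m, A 'X_[m] & mnm_supp m \subset T.
Proof.
move=> Amon.
(* Membership in [A] need not be decidable, so the family is chosen classically. *)
have /fin_all_exists[b bP] : forall T, exists b : bool,
    b <-> exists2 m, A 'X_[m] & mnm_supp m \subset T.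
  move=> T; have [AT|nAT] := boolp.pselect (exists2 m, A 'X_[m] & mnm_supp m \subset T).
    by exists true.
  by exists false.
have UE T : T \in [set T | b T] <-> exists2 m, A 'X_[m] & mnm_supp m \subset T.
  by rewrite inE.
have Uup : upset [set T | b T].
  move=> T T' /UE[m Am mT] TT'; apply/UE; exists m => //.
  exact: subset_trans mT TT'.
exists [set T | b T]; do 2?split=> //.
(* With the largest exponent of m, the power of the product over T is a multiple of ['X_[m]]. *)
- move=> T /UE[m Am /subsetP mT]; exists (\max_i m i).
  suff -> : set_mnm T (\max_i m i) = (set_mnm T (\max_i m i) - m + m)%MM.
    by rewrite mpolyXD; apply: monomial_idealM.
  apply/mnmP => i; rewrite mnmDE mnmBE mnmE; case: ifP => [_|/negbT iT].
    by rewrite subnK //; apply: leq_bigmax.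
  by have := contra (mT i) iT; rewrite inE negbK => /eqP ->.
- case: (Amon) => X AE f /AE[s sX ->]; apply: supported_sum_seq => u us.
  apply: supportedM; first exact: upclosed_supp.
  have [m Xm um] := sX _ us; rewrite um /supported msuppX /= andbT.
  by apply/UE; exists m => //; apply: monomial_ideal_mem AE Xm.
Qed.

Lemma supports_of_sum t (Bs : 'I_t -> S -> Prop) (Us : 'I_t -> {set {set 'I_n}})
    (I : {set 'I_t}) :
  (forall i, Bs i 0) -> (forall i, supports_of (Bs i) (Us i)) ->
  supports_of (ideal_sum Bs I) (\bigcup_(i in I) Us i).
Proof.
move=> Bs0 BsU; split=> [T T' /bigcupP[i iI TU] TT'|T /bigcupP[i iI TU]|_ [b bB ->]].
- by apply/bigcupP; exists i => //; have [Uup _ _] := BsU i; apply: Uup TU TT'.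
- have [_ /(_ _ TU)[N BN] _] := BsU i; exists N.
  exists (fun j => if j == i then 'X_[set_mnm T N] else 0) => [j _|].
    by case: eqP => [->|].
  rewrite (bigD1 i) //= eqxx big1 ?addr0 // => j /andP[_ /negPf ->] //.
- apply: supported_sum => i iI; have [_ _ /(_ _ (bB i iI))/allP bU] := BsU i.
  by apply/allP => m /bU mU; apply/bigcupP; exists i.
Qed.

Definition indicator T (i : 'I_n) : R := (i \in T)%:R.

Lemma meval_indicatorX T m :
  'X_[m].@[indicator T] = (mnm_supp m \subset T)%:R :> R.
Proof.
rewrite mevalX; have [/subsetP mT|/subsetPn[i im iT]] := boolP (mnm_supp m \subset T).
  apply: big1 => i _; rewrite /indicator; case: (boolP (i \in T)) => [_|iT].
    by rewrite expr1n.
  by have := contra (mT i) iT; rewrite inE negbK => /eqP ->.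
rewrite (bigD1 i) //= /indicator (negPf iT) expr0n.
by move: im; rewrite inE => /negPf ->; rewrite mul0r.
Qed.

(** The preimage of the prime [Q] under evaluation is prime. A monomial evaluates to 1 if its
    support lies in T and to 0 otherwise, so the preimage contains [A] exactly when no monomial of
    [A] has support inside T. *)
Lemma in_V_indicator A U T (Q : R -> Prop) : monomial_ideal A ->
    (forall T, T \in U <-> exists2 m, A 'X_[m] & mnm_supp m \subset T) ->
    prime_ideal Q ->
  in_V A (fun f => Q f.@[indicator T]) <-> T \notin U.
Proof.
move=> [X AE] UE [[Q0 QD QM] Q1 Qprime]; split=> [[_ AQ]|TU].
  apply/negP => /UE[m /AQ]; rewrite meval_indicatorX => Qm mT.
  by rewrite mT in Qm.
split=> [|f /AE[s sX ->]].
  split; first split=> [|f g fQ gQ|f g gQ].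
  - by rewrite meval0.
  - by rewrite mevalD; apply: QD.
  - by rewrite mevalM; apply: QM.
  - by rewrite meval1.
  - by move=> f g; rewrite mevalM => /Qprime.
rewrite raddf_sum big1_seq //= => u us; have [m Xm um] := sX _ us.
rewrite mevalM um meval_indicatorX.
case: (boolP (mnm_supp m \subset T)) => [mT|_]; last by rewrite mulr0.
by case/negP: TU; apply/UE; exists m => //; apply: monomial_ideal_mem AE Xm.
Qed.

End SupportsOfMonomialIdeals.

(** * From supports back to local cohomology *)

Lemma torsion_coboundary_supports (R : comNzRingType) (G : zmodType) (n : nat)
    (deg : 'I_n -> G) (M : gmod R deg) (E : graded_injective_resolution M) p A U i
    (x : res_obj E i) :
  supports_of A U -> torsion_coboundary A p x <-> supp_coboundary p U x.
Proof.
move=> AU; case: i x => [|i] x //=.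
by split=> -[y [yp yA ->]]; exists y; split=> //; apply/(torsion_supports _ AU).
Qed.

Theorem proposition5p4 (R : comNzRingType) (R_noetherian : noetherian R)
    (G : zmodType) (G_fin_gen : fin_gen_group G)
    (n : nat) (deg : 'I_n -> G)
    (B : {mpoly R[n]} -> Prop) (B_monomial : monomial_ideal B)
    (t : nat) (Bs : 'I_t -> {mpoly R[n]} -> Prop)
    (Bs_monomial : forall i, monomial_ideal (Bs i))
    (VB : forall P : {mpoly R[n]} -> Prop, in_V B P <-> exists i, in_V (Bs i) P)
    (M : gmod R deg) (l : nat) (c : 'I_l -> G) (m : G) :
  reg_family c Bs M m -> reg c B M m.
Proof.
have [UB [BU UBE]] := monomial_ideal_supports B_monomial.
have /fin_all_exists[Us UsP] i := monomial_ideal_supports (Bs_monomial i).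
(* The primes attached to subsets T, over one fixed prime of [R], turn the hypothesis on closed sets
   into an equality of families. *)
have UsE : UB = \bigcap_i Us i.
  have [Q Qprime] := exists_prime_ideal R.
  have VU := @in_V_indicator R n.
  apply/setP => T; apply/idP/bigcapP => [TU i _|TUs].
    apply: contraLR TU => TUi; apply/(VU _ _ _ _ B_monomial UBE Qprime)/VB.
    by exists i; apply/(VU _ _ _ _ (Bs_monomial i) (UsP i).2 Qprime).
  apply: contraT => /(VU _ _ _ _ B_monomial UBE Qprime)/VB[i].
  by move/(VU _ _ _ _ (Bs_monomial i) (UsP i).2 Qprime); rewrite TUs.
have Us_up i : upset (Us i) by have [[]] := UsP i.
move=> reg_m i g ig E x [xp /(torsion_supports _ BU) xU dx].
apply/(torsion_coboundary_supports _ _ BU).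
(* The induction starts with [W] empty, which corresponds to the zero ideal. *)
suff : supp_acyclic E (m + g) (set0 :|: \bigcap_i Us i) i.
  by rewrite set0U -UsE; apply.
apply: supp_acyclic_bigcap => // [|T T'|I I0 _]; first exact: index_enum_uniq.
  by rewrite inE.
rewrite set0U => y yp yU dy.
(* The union over I is the family of the sum of ideals, to which [reg_m] applies with its shift by
   [#|I|] - 1. *)
have sumU : supports_of (ideal_sum Bs I) (\bigcup_(i in I) Us i).
  apply: supports_of_sum => j; first exact: monomial_ideal0.
  by have [] := UsP j.
apply/(torsion_coboundary_supports _ _ sumU)/(reg_m i I I0 g ig E y); split=> //.
exact/(torsion_supports _ sumU).
Qed.
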